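(* Post's Correspondence Problem is many-to-one reducible to the existential theory of $\mathcal{T}(\mathcal{L}_{\mathsf{BT}})$: there is a computable map sending each instance of PCP to an existential $\mathcal{L}_{\mathsf{BT}}$-sentence which is true in $\mathcal{T}(\mathcal{L}_{\mathsf{BT}})$ if and only if the instance has a solution.
   Context: Post's Correspondence Problem (PCP): an instance is a list of pairs $\langle a_1,b_1\rangle,\ldots,\langle a_n,b_n\rangle$ of nonempty binary strings; a solution is a finite nonempty sequence of indices $i_1,\ldots,i_m$ with $a_{i_1}\cdots a_{i_m}=b_{i_1}\cdots b_{i_m}$. Let $\mathbf{H}$ be the set of variable-free terms built from a constant $\perp$ and a binary function symbol $\langle\cdot,\cdot\rangle$. The substitution $t[r\mapsto s]$ is the term obtained by replacing each occurrence of $r$ in $t$ by $s$ (formally: $s$ if $t=r$; $\perp$ if $t\ne r$, $t=\perp$; $\langle t_1[r\mapsto s],t_2[r\mapsto s]\rangle$ if $t\ne r$, $t=\langle t_1,t_2\rangle$). $\mathcal{T}(\mathcal{L}_{\mathsf{BT}})=(\mathbf{H},\perp,\langle\cdot,\cdot\rangle,\cdot[\cdot\mapsto\cdot])$ in the language $\mathcal{L}_{\mathsf{BT}}=\{\perp,\langle\cdot,\cdot\rangle,\cdot[\cdot\mapsto\cdot]\}$. An existential sentence is one built from atomic formulas and their negations using $\wedge,\vee$ and unbounded $\exists$, with no free variables. *)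

(* Defs.v *)
From HB Require Import structures.
From mathcomp Require Import all_boot.

Set Implicit Arguments.
Unset Strict Implicit.
Unset Printing Implicit Defensive.

Definition pcp_wf (s : seq (seq bool * seq bool)) : bool :=
  all (fun ab => (ab.1 != [::]) && (ab.2 != [::])) s.

Definition pcp_instance := {s : seq (seq bool * seq bool) | pcp_wf s}.

Definition pcp_solution (I : pcp_instance) (w : seq 'I_(size (val I))) : Prop :=
  w != [::] /\
  flatten [seq (tnth (in_tuple (val I)) i).1 | i <- w] =
  flatten [seq (tnth (in_tuple (val I)) i).2 | i <- w].

Definition pcp_solvable (I : pcp_instance) : Prop :=
  exists w : seq 'I_(size (val I)), pcp_solution w.

Inductive tree := Bot | Node of tree & tree.

Fixpoint tree_eqb (t u : tree) : bool :=
  match t, u with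
  | Bot, Bot => true
  | Node t1 t2, Node u1 u2 => tree_eqb t1 u1 && tree_eqb t2 u2
  | _, _ => false
  end.

Lemma tree_eqP : Equality.axiom tree_eqb.
Proof.
elim=> [|t1 IH1 t2 IH2] [|u1 u2] /=; try by constructor.
by apply: (iffP andP) => [[/IH1-> /IH2->]|[<- <-]] //; split; [apply/IH1|apply/IH2].
Qed.

HB.instance Definition _ := hasDecEq.Build tree tree_eqP.

(* [tree_subst t r s] is t[r |-> s]. *)
Fixpoint tree_subst (t r s : tree) : tree :=
  if t == r then s else
  match t with
  | Bot => Bot
  | Node t1 t2 => Node (tree_subst t1 r s) (tree_subst t2 r s)
  end.

Inductive term :=
| TVar of nat
| TBot
| TNode of term & term
| TSubst of term & term & term.

Inductive eformula :=
| FEq of term & term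
| FNeq of term & term
| FAnd of eformula & eformula
| FOr of eformula & eformula
| FEx of nat & eformula.

Fixpoint term_vars (t : term) : seq nat :=
  match t with
  | TVar x => [:: x]
  | TBot => [::]
  | TNode t1 t2 => term_vars t1 ++ term_vars t2
  | TSubst t1 t2 t3 => term_vars t1 ++ term_vars t2 ++ term_vars t3
  end.

Fixpoint free_vars (phi : eformula) : seq nat :=
  match phi with
  | FEq t u | FNeq t u => term_vars t ++ term_vars u
  | FAnd phi1 phi2 | FOr phi1 phi2 => free_vars phi1 ++ free_vars phi2
  | FEx x phi1 => [seq y <- free_vars phi1 | y != x]
  end.

Definition esentence := {phi : eformula | free_vars phi == [::]}.

Fixpoint term_val (v : nat -> tree) (t : term) : tree :=
  match t with
  | TVar x => v x
  | TBot => Bot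
  | TNode t1 t2 => Node (term_val v t1) (term_val v t2)
  | TSubst t1 t2 t3 => tree_subst (term_val v t1) (term_val v t2) (term_val v t3)
  end.

Fixpoint holds (v : nat -> tree) (phi : eformula) : Prop :=
  match phi with
  | FEq t u => term_val v t = term_val v u
  | FNeq t u => term_val v t <> term_val v u
  | FAnd phi1 phi2 => holds v phi1 /\ holds v phi2
  | FOr phi1 phi2 => holds v phi1 \/ holds v phi2
  | FEx x phi1 => exists a : tree, holds [eta v with x |-> a] phi1
  end.

(* The assignment v is irrelevant, as phi has no free variable. *)
Definition existential_theory (phi : esentence) : Prop :=
  forall v : nat -> tree, holds v (val phi).

(* Syntax of Kleene's n-ary partial recursive functions. *)
Inductive recfun : nat -> Type :=
| RZero n : recfun n
| RSucc : recfun 1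
| RProj n : 'I_n -> recfun n
| RComp m n : recfun m -> ('I_m -> recfun n) -> recfun n
| RPrec n : recfun n -> recfun n.+2 -> recfun n.+1
| RMin n : recfun n.+1 -> recfun n.

(* [rec_eval p v y]: the program p halts on the arguments v with output y. *)
Fixpoint rec_eval n (p : recfun n) : n.-tuple nat -> nat -> Prop :=
  match p in recfun n return n.-tuple nat -> nat -> Prop with
  | RZero _ => fun _ y => y = 0
  | RSucc => fun v y => y = (thead v).+1
  | RProj _ i => fun v y => y = tnth v i
  | RComp m _ g h => fun v y =>
      exists w : m.-tuple nat,
        (forall i, rec_eval (h i) v (tnth w i)) /\ rec_eval g w y
  | RPrec _ g h => fun v =>
      (fix loop (k : nat) : nat -> Prop :=
         match k with
         | 0 => rec_eval g [tuple of behead v]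
         | k'.+1 => fun y => exists r : nat,
             loop k' r /\ rec_eval h [tuple of k' :: r :: behead v] y
         end) (thead v)
  | RMin _ f => fun v y =>
      rec_eval f [tuple of y :: v] 0 /\
      (forall z, z < y -> exists k : nat, rec_eval f [tuple of z :: v] k.+1)
  end.

(* Elements of A and B are represented by the Goedel numbers codeA and codeB. *)
Definition computable (A B : Type) (codeA : A -> nat) (codeB : B -> nat)
    (f : A -> B) : Prop :=
  exists p : recfun 1, forall a : A, rec_eval p [tuple codeA a] (codeB (f a)).

(* [CodeSeq.code] is a bijection from [seq nat] to [nat]. *)
Definition code_string (s : seq bool) : nat :=
  CodeSeq.code [seq nat_of_bool b | b <- s].

Definition code_pcp (I : pcp_instance) : nat :=
  CodeSeq.code
    [seq CodeSeq.code [:: code_string ab.1; code_string ab.2] | ab <- val I].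

Fixpoint code_term (t : term) : nat :=
  match t with
  | TVar x => CodeSeq.code [:: 0; x]
  | TBot => CodeSeq.code [:: 1]
  | TNode t1 t2 => CodeSeq.code [:: 2; code_term t1; code_term t2]
  | TSubst t1 t2 t3 =>
      CodeSeq.code [:: 3; code_term t1; code_term t2; code_term t3]
  end.

Fixpoint code_eformula (phi : eformula) : nat :=
  match phi with
  | FEq t u => CodeSeq.code [:: 0; code_term t; code_term u]
  | FNeq t u => CodeSeq.code [:: 1; code_term t; code_term u]
  | FAnd phi1 phi2 =>
      CodeSeq.code [:: 2; code_eformula phi1; code_eformula phi2]
  | FOr phi1 phi2 =>
      CodeSeq.code [:: 3; code_eformula phi1; code_eformula phi2]
  | FEx x phi1 => CodeSeq.code [:: 4; x; code_eformula phi1]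
  end.

Definition code_esentence (phi : esentence) : nat := code_eformula (val phi).

(* Main.v *)
Require Import Defs.
From mathcomp Require Import all_boot.

Set Implicit Arguments.
Unset Strict Implicit.
Unset Printing Implicit Defensive.

(* A word is a right comb of letters ending in a leaf, the hole, and is read from that
   leaf upwards, so that substituting for the hole puts letters in front. In a marked
   word the leaf is a mark instead. A list M is a derivation in which each step inserts
   words of rs at holes, if replacing the marked words of rs in M by the hole and appending
   the result z gives the same list as turning the marks of M into holes and putting the
   start o in front. This is a single equation, and it defines the set rs^* of words as
   well as lists of words of rs^*.

   Let alpha_i = 2^i 3 a_i and beta_i = 2^i 3 b_i. The instance is solvable iff some
   nonempty alpha_{i_1}...alpha_{i_m} and some beta_{j_1}...beta_{j_l} have the same
   subword on {0, 1} and the same subword on {2, 3}, that is, iff one can be turned into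
   the other by swapping adjacent letters of different kinds. Such a sequence of swaps is
   a list of rows in which each row, read after its swaps, is the next row read before its
   swaps; both readings are letter-to-letter substitutions, so this again is one equation
   between lists. *)

(** * Trees, words and derivations *)

Fixpoint occ (r t : tree) : bool :=
  (t == r) || (if t is Node a b then occ r a || occ r b else false).

Lemma occ_refl t : occ t t.
Proof. by case: t => [|a b]; apply/orP; left; apply: eqxx. Qed.

Lemma substE t r s : tree_subst t r s =
  if t == r then s else
  if t is Node a b then Node (tree_subst a r s) (tree_subst b r s) else Bot.
Proof. by case: t. Qed.

Lemma subst_id r s t : ~~ occ r t -> tree_subst t r s = t.
Proof.
elim: t => [|a IHa b IHb] /=; rewrite !negb_or => /andP[/negPf->] //.
by case/andP=> /IHa-> /IHb->.
Qed.

Lemma occ_subst r s t : occ r t -> occ s (tree_subst t r s).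
Proof.
elim: t => [|a IHa b IHb]; rewrite substE [occ r _]/=; case: eqP => _; rewrite ?occ_refl //=.
by case/orP=> [/IHa->|/IHb->]; rewrite ?orbT.
Qed.

(** Any replacement would leave a copy of [s] in the result. *)
Lemma subst_inv r s t u : ~~ occ s u -> tree_subst t r s = u -> t = u.
Proof.
move=> Hs; case: (boolP (occ r t)) => [/(occ_subst s) + E|/subst_id-> //].
by rewrite E (negPf Hs).
Qed.

Lemma subst_self t s : tree_subst t t s = s.
Proof. by rewrite substE eqxx. Qed.

Lemma subst_node r s a b : Node a b <> r ->
  tree_subst (Node a b) r s = Node (tree_subst a r s) (tree_subst b r s).
Proof. by move=> /eqP/negPf N; rewrite substE N. Qed.

(** * Atoms and words as trees *)

Fixpoint comb n := if n is n'.+1 then Node (comb n') Bot else Bot.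
(** Not a comb, as its right child is not [Bot]; hence no comb contains an atom. *)
Definition root := Node Bot (Node Bot Bot).
(* Atoms are pairwise incomparable for the subterm order. *)
Definition atom n := Node root (comb n).

Lemma occ_atom_comb i n : occ (atom i) (comb n) = false.
Proof.
elim: n => [|n IH] //=; rewrite IH /= orbF.
by apply/negbTE/eqP => -[]; case: n {IH}.
Qed.

Lemma comb_inj : injective comb.
Proof. by elim=> [|m IH] [|n] //= [/IH->]. Qed.

Lemma occ_atom i j : occ (atom i) (atom j) = (i == j).
Proof.
rewrite /= occ_atom_comb !orbF [LHS]/=; apply/eqP/eqP => [|->//].
by case=> /comb_inj.
Qed.

Definition hole := atom 0.
Definition mark := atom 1.
Definition eps := atom 2.
(** Lists of words end in [eps]; a chain whose entries are such lists must end in another atom. *)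
Definition delta := atom 3.
Definition letter k := atom k.+4.

Definition word (u : seq nat) (x : tree) :=
  foldl (fun t l => Node (letter l) t) x u.

Lemma word_cat u v x : word (u ++ v) x = word v (word u x).
Proof. exact: foldl_cat. Qed.

Lemma word_rcons u l x : word (rcons u l) x = Node (letter l) (word u x).
Proof. by rewrite -cats1 word_cat. Qed.

Lemma occ_letter i l : i < 4 -> occ (atom i) (letter l) = false.
Proof. by rewrite occ_atom; case: i => [|[|[|[|]]]]. Qed.

Lemma occ_node r a b : occ r (Node a b) = [|| Node a b == r, occ r a | occ r b].
Proof. by []. Qed.

Lemma occ_word i u x : i < 4 -> occ (atom i) (word u x) = occ (atom i) x.
Proof.
move=> lti; elim/last_ind: u => // u l IH.
by rewrite word_rcons occ_node occ_letter // IH.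
Qed.

Lemma word_inj i : injective (word^~ (atom i)).
Proof.
elim/last_ind=> [|u l IH]; elim/last_ind=> [|v k _] //; rewrite ?word_rcons //.
by case=> /comb_inj-> /IH->.
Qed.

(** * Marked words and soundness of the chain equations *)

Definition lst (e : tree) (us : seq tree) := foldr Node e us.

Definition subst_words (rs : seq (seq nat)) (t : tree) :=
  foldl (fun t a => tree_subst t (word a mark) hole) t rs.
Definition unmark (t : tree) := tree_subst t mark hole.

Lemma occ_mark_word a : occ mark (word a mark).
Proof. by rewrite occ_word // occ_refl. Qed.

Lemma occ_trans r s t : occ r s -> occ s t -> occ r t.
Proof.
move=> rs; elim: t => [|a IHa b IHb] /= /orP[/eqP E|] //; first by rewrite -E in rs.
  by rewrite -E in rs.
by case/orP=> [/IHa->|/IHb->]; rewrite !orbT.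
Qed.

Lemma subst_unmarked a t : ~~ occ mark t -> tree_subst t (word a mark) hole = t.
Proof.
by move=> H; rewrite subst_id //; apply: contra H; apply: occ_trans; apply: occ_mark_word.
Qed.

Lemma subst_words_id rs t : ~~ occ mark t -> subst_words rs t = t.
Proof. by move=> H; elim: rs => // a rs IH /=; rewrite subst_unmarked. Qed.

Lemma unmark_id t : ~~ occ mark t -> unmark t = t.
Proof. exact: subst_id. Qed.

Lemma subst_words_inv rs t X :
  ~~ occ hole X -> subst_words rs t = X -> t = X.
Proof.
move=> H; elim: rs t => //= a rs IH t /IH; exact: subst_inv.
Qed.

(** A tree replaced as a whole becomes [hole], whose left child is [root] and which later
    substitutions leave alone. *)
Lemma subst_words_node_inv rs M o q : o <> root ->
  subst_words rs M = Node o q ->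
  exists m M', [/\ M = Node m M', subst_words rs m = o & subst_words rs M' = q].
Proof.
move=> No; elim: rs M => [|a rs IH] M /=; first by exists o, q.
case/IH=> m [M' [E Em EM']].
case: (M =P word a mark) E => [->|NM].
  rewrite subst_self => E; case: No; rewrite -Em.
  by case: E => <- _; rewrite subst_words_id.
case: M NM => [|x y] NM; first by rewrite /=; case: eqP.
rewrite subst_node // => -[ex ey].
by exists x, y; rewrite /= ex ey.
Qed.

(* [expand rs X t] overapproximates [subst_words rs t = X], which says that t arises
   from X by replacing some holes by marked words of rs. *)
Inductive expand (rs : seq (seq nat)) : tree -> tree -> Prop :=
| Expand_hole a : a \in rs -> expand rs hole (word a mark)
| Expand_id t : expand rs t t
| Expand_node X Y t u : expand rs X t -> expand rs Y u ->
    expand rs (Node X Y) (Node t u).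

Lemma expand_unmarked rs X t : expand rs X t -> ~~ occ mark t -> X = t.
Proof.
elim=> //= [a _|{}X Y {}t u _ IH1 _ IH2]; first by rewrite occ_mark_word.
by rewrite !negb_or => /and3P[_ /IH1-> /IH2->].
Qed.

Lemma expand_closed rs X t : expand rs X t -> ~~ occ hole X -> t = X.
Proof.
elim=> //= {}X Y {}t u _ IH1 _ IH2.
by rewrite !negb_or => /and3P[_ /IH1-> /IH2->].
Qed.

Lemma occ_hole_word a : ~~ occ hole (word a mark).
Proof. by rewrite occ_word. Qed.

(** In the node case, if [t] is itself the marked word, its image is the hole, which has no mark;
    [X] must then be the hole as well, and [Expand_hole] applies. Otherwise the substitution acts on
    the children. *)
Lemma expand_subst rs a X t :
  expand rs X (tree_subst t (word a mark) hole) -> expand (a :: rs) X t.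
Proof.
move: {1 3}(tree_subst _ _ _) (erefl (tree_subst t (word a mark) hole)) => t1 + H.
elim: H t => [b br|{}t1|{}X Y t2 u H1 IH1 H2 IH2] t E.
- rewrite (subst_inv (occ_hole_word b) (esym E)).
  by apply: Expand_hole; rewrite inE br orbT.
- rewrite E {E}; elim: t => [|x IHx y IHy].
    by rewrite /=; case: eqP => [->|_]; [apply: Expand_hole; rewrite mem_head|apply: Expand_id].
  case: (Node x y =P word a mark) => [->|N].
    by rewrite subst_self; apply: Expand_hole; rewrite mem_head.
  by rewrite subst_node //; apply: Expand_node.
- case: (t =P word a mark) E => [->|N].
    rewrite subst_self => E.
    have Nm : ~~ occ mark (Node t2 u) by rewrite E.
    rewrite (expand_unmarked (Expand_node H1 H2) Nm) E.
    by apply: Expand_hole; rewrite mem_head.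
  case: t N => [|x y] N; first by rewrite /=; case: eqP.
  by rewrite subst_node // => -[E1 E2]; apply: Expand_node; [apply: IH1|apply: IH2].
Qed.

Lemma expand_subst_words rs t : expand rs (subst_words rs t) t.
Proof.
elim: rs t => [|a rs IH] t /=; first exact: Expand_id.
by apply: expand_subst; apply: IH.
Qed.

Lemma expand_node_inv rs X Y t : X <> root -> expand rs (Node X Y) t ->
  exists x y, [/\ t = Node x y, expand rs X x & expand rs Y y].
Proof.
move=> N H; inversion H; subst => //.
  by exists X, Y; split => //; apply: Expand_id.
by exists t0, u.
Qed.

(** The leaf is the only hole of the word. *)
Lemma expand_word rs u t : expand rs (word u hole) t ->
  t = word u hole \/ exists2 a, a \in rs & t = word (a ++ u) mark.
Proof.
elim/last_ind: u t => [|u l IH] t.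
  case: (boolP (occ mark t)) => [Hm H|Nm /expand_unmarked]; last by move/(_ Nm)->; left.
  inversion H; subst; first by right; exists a; rewrite ?cats0.
    by left.
  by left; rewrite (expand_closed H2) ?(expand_closed H4).
rewrite word_rcons => /expand_node_inv[] // x [y [-> Hx Hy]].
rewrite (expand_closed Hx) ?occ_atom //.
case: (IH _ Hy) => [->|[a ar ->]]; first by left.
by right; exists a; rewrite // -rcons_cat word_rcons.
Qed.

Lemma unmark_word v : unmark (word v mark) = word v hole.
Proof.
elim/last_ind: v => [|v l IH]; first exact: subst_self.
by rewrite !word_rcons -IH /unmark subst_node // (@subst_id _ _ (letter l)) ?occ_letter.
Qed.

Definition star_word (rs : seq (seq nat)) (X : tree) :=
  exists2 bs, all (mem rs) bs & X = word (flatten bs) hole.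

Lemma star_word_expand rs X m :
  star_word rs X -> expand rs X m -> star_word rs (unmark m) /\ m <> root.
Proof.
case=> bs Hbs -> /expand_word[->|[a ar ->]].
  rewrite unmark_id ?occ_word //; split; first by exists bs.
  by elim/last_ind: (flatten bs) => // u l _; rewrite word_rcons.
split.
  exists (a :: bs); first by apply/andP.
  exact: unmark_word.
by elim/last_ind: (a ++ _) => // u l _; rewrite word_rcons.
Qed.

Lemma star_word_root rs X : star_word rs X -> X <> root.
Proof.
move=> H; have [] := star_word_expand H (@Expand_id rs X); by [].
Qed.

Inductive star_list (rs : seq (seq nat)) : tree -> Prop :=
| Star_nil : star_list rs eps
| Star_cons X Y : star_word rs X -> star_list rs Y -> star_list rs (Node X Y).

Lemma star_list_expand rs X m :
  star_list rs X -> expand rs X m -> star_list rs (unmark m).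
Proof.
move=> H; elim: H m => [m /expand_closed-> //|]; first exact: Star_nil.
move=> {}X Y HX HY IH m /expand_node_inv[]; first exact: star_word_root HX.
move=> x [y [-> Ex Ey]].
have [Sx Nx] := star_word_expand HX Ex.
rewrite /unmark subst_node; last by case.
by apply: Star_cons; [|apply: IH].
Qed.

(* If M is the list m_1, ..., m_k ended by e, the equation says that
   [subst_words rs m_1 = o], [subst_words rs m_(i+1) = unmark m_i] and
   [z = unmark m_k]. *)
Lemma chain_sound rs j (P : tree -> Prop) : 1 < j ->
  (forall X, P X -> ~~ occ (atom j) X /\ X <> root) ->
  (forall X m, P X -> expand rs X m -> P (unmark m)) ->
  forall M o z, P o ->
  tree_subst (subst_words rs M) (atom j) (Node z (atom j)) = Node o (unmark M) ->
  P z.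
Proof.
move=> j1 HP Pstep; set e := atom j.
have e0 : ~~ occ hole e by rewrite occ_atom; case: j j1 {HP e}.
have e1 : ~~ occ mark e by rewrite occ_atom; case: j j1 {HP e e0} => [|[]].
(* [M] is an arbitrary tree; the equation forces it to be a list ended by [e], and the induction
   peels off its entries. *)
elim=> [|m IHm M IHM] o z Po.
  by rewrite subst_words_id //= => -[].
have [No oR] := HP _ Po.
(* At the end of the list the equation reads [Node z e = Node o e]. *)
case: (subst_words rs (Node m M) =P e) => [E|NE].
  by rewrite E (subst_words_inv e0 E) subst_self unmark_id // => -[->].
case Es: (subst_words rs (Node m M)) NE => [|p q] NE //.
rewrite subst_node // => -[Ep Eq].
(* A replacement would have put an [e] into the first entry, but [o] contains none. *)
have Epo : p = o.
  apply: subst_inv Ep; apply: contra No; apply: occ_trans.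
  by rewrite occ_node occ_refl !orbT.
rewrite Epo in Es.
have [m' [M' [[<- <-] Em EM]]] := subst_words_node_inv oR Es.
have Ex : expand rs o m by rewrite -Em; apply: expand_subst_words.
have mR : m <> root.
  by move=> mR; apply: oR; rewrite -Em mR subst_words_id.
move: Eq; rewrite /unmark subst_node; last by case.
by rewrite -EM; apply: IHM; apply: Pstep Ex.
Qed.

(* [Node m x] with m live is neither an atom nor a word, so that substitutions for
   these commute with [Node]. *)
Definition live (m : tree) := occ hole m || occ mark m.

Lemma live_subst_word a m : live m -> live (tree_subst m (word a mark) hole).
Proof.
case: (boolP (occ (word a mark) m)) => [/(occ_subst hole) H _|/subst_id-> //].
by rewrite /live H.
Qed.

Lemma live_subst_words rs m : live m -> live (subst_words rs m).
Proof. by elim: rs m => //= a rs IH m /(live_subst_word a)/IH. Qed.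

Lemma live_node_word x y a : live x -> Node x y <> word a mark.
Proof.
move=> Lx; elim/last_ind: a => [|a l _]; first by case=> E; rewrite E in Lx.
by rewrite word_rcons => -[E _]; move: Lx; rewrite E /live !occ_letter.
Qed.

Lemma subst_words_node rs x y : live x ->
  subst_words rs (Node x y) = Node (subst_words rs x) (subst_words rs y).
Proof.
elim: rs x y => // a rs IH x y Lx.
rewrite -[LHS]/(subst_words rs (tree_subst _ _ _)) subst_node; last exact: live_node_word.
by rewrite IH ?live_subst_word.
Qed.

Lemma unmark_node x y : live x -> unmark (Node x y) = Node (unmark x) (unmark y).
Proof. by move=> Lx; apply: subst_node; apply: (@live_node_word _ _ [::]). Qed.

(** * Completeness: derivations give solutions of the chain equations *)

(** One step goes from [subst_words rs m] to [unmark m], that is, inserts words at holes; the side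
    conditions let [m] be an entry of a list ended by [e]. *)
Inductive reach (rs : seq (seq nat)) (e : tree) : tree -> tree -> Prop :=
| Reach_refl X : reach rs e X X
| Reach_step m Z : live m -> ~~ occ e (subst_words rs m) ->
    reach rs e (unmark m) Z -> reach rs e (subst_words rs m) Z.

(** Converse of [chain_sound]: the trees [m] of the successive steps, listed and ended by [e], form
    [M]. *)
Lemma reach_chain rs j o z : 1 < j -> reach rs (atom j) o z -> exists M,
  tree_subst (subst_words rs M) (atom j) (Node z (atom j)) = Node o (unmark M).
Proof.
move=> j1; set e := atom j.
have e1 : ~~ occ mark e by rewrite occ_atom; case: j j1 {e} => [|[]].
elim=> [{o z}X|m {o}z' Lm Nm _ [M IH]].
  by exists e; rewrite subst_words_id // subst_self unmark_id.
exists (Node m M); rewrite subst_words_node // unmark_node // subst_node.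
  by rewrite subst_id // IH.
by case=> E; move: (live_subst_words rs Lm); rewrite E.
Qed.

Lemma reach_trans rs e X Y Z : reach rs e X Y -> reach rs e Y Z -> reach rs e X Z.
Proof. by elim=> // m {}Y Lm Nm _ IH /IH; apply: Reach_step. Qed.

(** Without marks and without [e], the component [Z] is unaffected by every step. *)
Lemma reach_node_left rs e X Y Z : ~~ occ mark Z -> ~~ occ e Z ->
  (forall x, Node x Z <> e) ->
  reach rs e X Y -> reach rs e (Node X Z) (Node Y Z).
Proof.
move=> Nm Ne Nn; elim=> [{}X|m {}Y Lm Nem _ IH]; first exact: Reach_refl.
rewrite -{1}(subst_words_id rs Nm) -subst_words_node //.
apply: Reach_step.
- by move: Lm; rewrite /live !occ_node => /orP[]->; rewrite !orbT.
- by rewrite subst_words_node // occ_node !negb_or Nem (subst_words_id rs Nm) Ne !andbT;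
    apply/eqP.
- by rewrite unmark_node // (unmark_id Nm).
Qed.

Lemma reach_node_right rs e X Y Z : live Z -> ~~ occ mark Z -> ~~ occ e Z ->
  (forall x, Node Z x <> e) ->
  reach rs e X Y -> reach rs e (Node Z X) (Node Z Y).
Proof.
move=> LZ Nm Ne Nn; elim=> [{}X|m {}Y Lm Nem _ IH]; first exact: Reach_refl.
rewrite -{1}(subst_words_id rs Nm) -subst_words_node //.
apply: Reach_step.
- by move: Lm; rewrite /live !occ_node => /orP[]->; rewrite !orbT.
- rewrite subst_words_node // occ_node !negb_or Nem (subst_words_id rs Nm) Ne !andbT.
  by apply/eqP.
- by rewrite unmark_node // (unmark_id Nm).
Qed.

(** A word is read from the leaf upwards, so the marked words inside a marked word are its
    prefixes. *)
Lemma subst_word_mark a v : tree_subst (word v mark) (word a mark) hole =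
  if prefix a v then word (drop (size a) v) hole else word v mark.
Proof.
elim/last_ind: v => [|v l IH].
  case: a => [|l a]; first exact: subst_self.
  rewrite subst_node; first by rewrite subst_unmarked // subst_unmarked.
  by rewrite -cat1s word_cat; elim/last_ind: a => // a k _; rewrite word_rcons.
case: (a =P rcons v l) => [->|N]; first by rewrite subst_self prefix_refl drop_size.
rewrite {1}word_rcons subst_node -?word_rcons; last by move/word_inj/esym.
have ->: prefix a (rcons v l) = prefix a v.
  apply/idP/idP=> [/prefixP[s]|]; last by rewrite -cats1; apply: prefix_catl.
  case/lastP: s => [|s k]; first by rewrite cats0 => /esym.
  by rewrite -rcons_cat => /rcons_inj[-> _]; apply: prefix_prefix.
rewrite subst_unmarked ?occ_letter // IH.
case: ifP => [/size_prefix le|_]; last by rewrite word_rcons.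
by rewrite drop_rcons // word_rcons.
Qed.

(** At most one word of [rs] is a prefix of a given word, so the successive substitutions of
    [subst_words] cannot compete. *)
Definition prefix_free (rs : seq (seq nat)) := forall a b u,
  a \in rs -> b \in rs -> prefix b (a ++ u) -> b = a.

Lemma subst_words_prefix_free rs a u : prefix_free rs -> a \in rs ->
  subst_words rs (word (a ++ u) mark) = word u hole.
Proof.
move=> pf ar; have: {in rs, forall b, prefix b (a ++ u) -> b = a}.
  by move=> b br; apply: pf.
elim: rs ar {pf} => // b rs IH; rewrite inE => ar H /=.
rewrite subst_word_mark; case: ifP => [/(H b (mem_head _ _))->|Nb].
  by rewrite drop_size_cat // subst_words_id // occ_word.
apply: IH => [|c cr]; last by apply: H; rewrite inE cr orbT.
by case/predU1P: ar => // E; rewrite -E prefix_prefix in Nb.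
Qed.

(** The single step uses [word (a ++ u) mark]: substitution removes exactly [a], while unmarking
    keeps the whole word. *)
Lemma reach_insert rs j a u : 1 < j -> j < 4 -> prefix_free rs -> a \in rs ->
  reach rs (atom j) (word u hole) (word (a ++ u) hole).
Proof.
move=> j1 j4 pf ar; rewrite -(subst_words_prefix_free u pf ar).
apply: Reach_step; rewrite ?unmark_word; last exact: Reach_refl.
  by rewrite /live occ_mark_word orbT.
by rewrite subst_words_prefix_free // occ_word // occ_atom; case: j j1 {j4}.
Qed.

Lemma reach_star_word rs j bs : 1 < j -> j < 4 -> prefix_free rs -> all (mem rs) bs ->
  reach rs (atom j) hole (word (flatten bs) hole).
Proof.
move=> j1 j4 pf; elim: bs => [|b bs IH] /=; first by move=> _; apply: Reach_refl.
by case/andP=> br /IH H; apply: reach_trans H _; apply: reach_insert.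
Qed.

Lemma node_word_atom i v x : Node (word v hole) x <> atom i.
Proof. by elim/last_ind: v => // v l _; rewrite word_rcons. Qed.

Lemma occ_lst i us : i \in [:: 1; 3] ->
  occ (atom i) (lst eps [seq word u hole | u <- us]) = false.
Proof.
rewrite !inE => Hi; elim: us => [|u us IH]; first by case/orP: Hi => /eqP->.
rewrite [lst _ _]/= occ_node IH orbF.
rewrite (introF eqP (@node_word_atom _ _ _)).
by case/orP: Hi => /eqP->; rewrite occ_word.
Qed.

Definition star_words (rs us : seq (seq nat)) :=
  forall u, u \in us -> exists2 bs, all (mem rs) bs & u = flatten bs.

(** The entries are built from the last to the first; those still waiting are holes, that is, empty
    words. *)
Lemma reach_star_list rs us : prefix_free rs -> star_words rs us ->
  reach rs delta (lst eps (nseq (size us) hole))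
    (lst eps [seq word u hole | u <- us]).
Proof.
move=> pf; elim: us => [|u us IH] H; first exact: Reach_refl.
have [bs Hbs ->] := H u (mem_head _ _); rewrite /=.
apply: (@reach_trans _ _ _ (Node hole (lst eps [seq word u hole | u <- us]))).
  apply: reach_node_right => //; apply: IH => v vu; apply: H.
  by rewrite inE vu orbT.
apply: reach_node_left; rewrite ?occ_lst //; first by case: (us) => [|v [|w vs]] x.
exact: reach_star_word.
Qed.

(** * Renaming letters, and equations between lists *)

Definition rename (ps : seq (nat * nat)) (t : tree) :=
  foldl (fun t p => tree_subst t (letter p.1) (letter p.2)) t ps.
Definition rename_letter (ps : seq (nat * nat)) (k : nat) :=
  foldl (fun k p => if k == p.1 then p.2 else k) k ps.

Lemma subst_letter_word p q i u : i < 4 ->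
  tree_subst (word u (atom i)) (letter p) (letter q) =
  word [seq if k == p then q else k | k <- u] (atom i).
Proof.
move=> i4; have Np j : j < 4 -> ~~ occ (letter p) (atom j).
  by rewrite occ_atom; case: j => [|[|[|[|]]]].
elim/last_ind: u => [|u l IH]; first by rewrite subst_id ?Np.
rewrite map_rcons !word_rcons subst_node // IH; congr Node.
case: eqP => [->|N]; first exact: subst_self.
by rewrite subst_id // occ_atom; apply/eqP => -[/esym].
Qed.

Lemma rename_lst ps us :
  rename ps (lst eps [seq word u hole | u <- us]) =
  lst eps [seq word (map (rename_letter ps) u) hole | u <- us].
Proof.
elim: ps us => [|p ps IH] us.
  by congr lst; apply: eq_map => u; rewrite map_id.
rewrite /rename /= -/(rename _ _).
have ->: tree_subst (lst eps [seq word u hole | u <- us]) (letter p.1) (letter p.2) =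
   lst eps [seq word u hole | u <- map (map (fun k => if k == p.1 then p.2 else k)) us].
  elim: us => [|u us IHus]; first by rewrite subst_id // occ_atom.
  by rewrite [lst _ _]/= subst_node ?IHus ?subst_letter_word //; apply: node_word_atom.
by rewrite IH -map_comp; congr lst; apply: eq_map => u /=; rewrite -map_comp.
Qed.

Lemma lst_inj us vs : lst eps [seq word u hole | u <- us] =
  lst eps [seq word u hole | u <- vs] -> us = vs.
Proof.
elim: us vs => [|u us IH] [|v vs] //.
- by move/esym/node_word_atom.
- by move/node_word_atom.
- by case=> /word_inj-> /IH->.
Qed.

Lemma subst_eps_lst us y :
  tree_subst (lst eps [seq word u hole | u <- us]) eps (Node (word y hole) eps) =
  lst eps [seq word u hole | u <- rcons us y].
Proof.
elim: us => [|u us IH]; first exact: subst_self.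
rewrite [lst _ _]/= subst_node; last exact: node_word_atom.
by rewrite IH subst_id // occ_word.
Qed.

(** Substituting for the terminator [eps] appends [y]; both sides are then lists and can be compared
    entry by entry. *)
Lemma rename_chain ps1 ps2 us x y :
  tree_subst (rename ps1 (lst eps [seq word u hole | u <- us])) eps
    (Node (word y hole) eps) =
  Node (word x hole) (rename ps2 (lst eps [seq word u hole | u <- us])) <->
  rcons (map (map (rename_letter ps1)) us) y = x :: map (map (rename_letter ps2)) us.
Proof.
have E ps : [seq word (map (rename_letter ps) u) hole | u <- us] =
  [seq word u hole | u <- map (map (rename_letter ps)) us] by rewrite -map_comp.
rewrite !rename_lst !E subst_eps_lst.
rewrite -[Node _ _]/(lst eps [seq word u hole | u <- x :: _]).
by split=> [/lst_inj|->].
Qed.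

(** Appending a hole has the same effect as prepending one, which forces every entry to be a
    hole. *)
Lemma unary_list O : tree_subst O eps (Node hole eps) = Node hole O ->
  exists k, O = lst eps (nseq k hole).
Proof.
elim: O => [|x _ y IH]; first by rewrite subst_id.
case: (Node x y =P eps) => [-> _|N]; first by exists 0.
rewrite subst_node // => -[/subst_inv-> // /IH[k ->]]; by exists k.+1.
Qed.

Lemma unary_listP k : let O := lst eps (nseq k hole) in
  tree_subst O eps (Node hole eps) = Node hole O.
Proof.
have E n : nseq n hole = [seq word u hole | u <- nseq n [::]] by rewrite map_nseq.
rewrite /= {1}E (subst_eps_lst _ [::]) -[Node _ _]/(lst eps (nseq k.+1 hole)).
by congr lst; elim: k => //= k ->.
Qed.

Lemma star_list_lst rs X : star_list rs X ->
  exists2 us, X = lst eps [seq word u hole | u <- us] & star_words rs us.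
Proof.
elim=> [|{}X Y [bs Hbs ->] _ [us -> Hus]]; first by exists [::].
exists (flatten bs :: us) => // u; rewrite inE => /predU1P[->|/Hus//].
by exists bs.
Qed.

(** The chain starts at a list of as many empty words as there are rows. This list [O] is a witness
    too, characterised by its own equation. *)
Lemma row_chain rs us : prefix_free rs -> star_words rs us -> exists H O,
  tree_subst O eps (Node hole eps) = Node hole O /\
  tree_subst (subst_words rs H) delta
     (Node (lst eps [seq word u hole | u <- us]) delta) = Node O (unmark H).
Proof.
move=> pf Hus; have [//|H EH] := @reach_chain rs 3 _ _ _ (reach_star_list pf Hus).
by exists H, (lst eps (nseq (size us) hole)); split=> //; apply: unary_listP.
Qed.

Lemma row_chain_inv rs H O S :
  tree_subst O eps (Node hole eps) = Node hole O ->
  tree_subst (subst_words rs H) delta (Node S delta) = Node O (unmark H) ->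
  exists2 us, S = lst eps [seq word u hole | u <- us] & star_words rs us.
Proof.
case/unary_list=> k -> E; apply: star_list_lst.
apply: (@chain_sound rs 3 (star_list rs) _ _ _ H _ S _ E) => //.
- move=> X /star_list_lst[us -> _]; rewrite occ_lst //; split=> //.
  case: us => // u us []; by elim/last_ind: u => // u l _; rewrite word_rcons.
- exact: star_list_expand.
elim: k {E} => [|k IH]; [exact: Star_nil|apply: Star_cons => //].
by exists [::].
Qed.

Lemma word_chain rs bs : prefix_free rs -> all (mem rs) bs -> exists V,
  tree_subst (subst_words rs V) eps (Node (word (flatten bs) hole) eps) =
  Node hole (unmark V).
Proof. by move=> pf Hbs; apply: (@reach_chain rs 2) => //; apply: reach_star_word. Qed.

Lemma word_chain_inv rs V x :
  tree_subst (subst_words rs V) eps (Node x eps) = Node hole (unmark V) ->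
  exists2 bs, all (mem rs) bs & x = word (flatten bs) hole.
Proof.
move=> E; apply: (@chain_sound rs 2 (star_word rs) _ _ _ V _ x _ E) => //.
- by move=> X HX; split; [case: HX => bs _ ->; rewrite occ_word|apply: star_word_root HX].
- by move=> X m HX /(star_word_expand HX)[].
by exists [::].
Qed.

(** * Correspondence and swaps *)

(* Rows use the letters 0, 1 for bits and 2, 3 for index words; [swap_letter p q]
   reads p before a swap of p and q, and q after it. *)
Definition bits (u : seq nat) := [seq k <- u | k < 2].
Definition indices (u : seq nat) := [seq k <- u | 1 < k].

(** All pairs of letters of different kinds, in both orders, so that swaps can be undone. *)
Definition swaps : seq (nat * nat) :=
  [:: (0, 2); (0, 3); (1, 2); (1, 3); (2, 0); (3, 0); (2, 1); (3, 1)].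
Definition swap_letter (p q : nat) := 4 + 4 * p + q.
(** A row is cut into letters left alone and pairs to be swapped; the block of the pair [(p, q)]
    reads [p q] before and [q p] after. *)
Definition blocks : seq (seq nat) :=
  [:: [:: 0]; [:: 1]; [:: 2]; [:: 3]] ++
  [seq [:: swap_letter pq.1 pq.2; swap_letter pq.2 pq.1] | pq <- swaps].
(** Sources are at least 4 and targets below 4, so a renamed letter is never renamed again. *)
Definition before := [seq (swap_letter pq.1 pq.2, pq.1) | pq <- swaps].
Definition after := [seq (swap_letter pq.1 pq.2, pq.2) | pq <- swaps].

Definition old (u : seq nat) := map (rename_letter before) u.
Definition new (u : seq nat) := map (rename_letter after) u.

(** Blocks are nonempty and determined by their first letters, which is checked by computation. *)
Lemma blocks_prefix_free : prefix_free blocks.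
Proof.
have H: all (fun a => all (fun b =>
    [&& a != [::], b != [::] & (head 0 a == head 0 b) ==> (a == b)]) blocks) blocks by [].
move=> a b u /(allP H)/allP Ha /Ha/and3P[].
by case: a {Ha} => [|k a]; case: b => [|l b] //= _ _ /implyP Hb /andP[/eqP E _];
  apply/esym/eqP/Hb; rewrite E.
Qed.

(** A block swaps letters of different kinds only, so neither subword is reordered. *)
Lemma block_sound bs : all (mem blocks) bs ->
  bits (old (flatten bs)) = bits (new (flatten bs)) /\
  indices (old (flatten bs)) = indices (new (flatten bs)).
Proof.
have H: all (fun b => (bits (old b) == bits (new b)) &&
    (indices (old b) == indices (new b))) blocks by [].
elim: bs => //= b bs IH /andP[/(allP H)/andP[/eqP E1 /eqP E2]] /IH[E3 E4].
by rewrite /bits /indices /old /new !map_cat !filter_cat -/(old _) -/(new _) -!/(bits _)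
  -!/(indices _) E1 E2 E3 E4.
Qed.

(** * Sequences of swaps *)

(** For rows [us_1, ..., us_k] with [k > 0] the equation says [u = old us_1],
    [new us_i = old us_(i+1)] and [new us_k = v]; no rows give [u = v]. *)
Definition connected (u v : seq nat) := exists2 us, star_words blocks us &
  rcons (map old us) v = u :: map new us.

Lemma connected_sound u v : connected u v -> bits u = bits v /\ indices u = indices v.
Proof.
case=> us; elim: us u => [|s us IH] u H /=; first by case=> ->.
case=> <- /IH[]; first by move=> t tu; apply: H; rewrite inE tu orbT.
by move=> <- <-; have [bs /block_sound Hbs ->] := H s (mem_head _ _).
Qed.

Lemma connected_refl u : connected u u.
Proof. by exists [::]. Qed.

Lemma connected_trans u v w : connected u v -> connected v w -> connected u w.
Proof.
case=> us Hus Eu [vs Hvs Ev]; exists (us ++ vs).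
  by move=> x; rewrite mem_cat => /orP[/Hus|/Hvs].
by rewrite !map_cat rcons_cat Ev -cat_rcons Eu.
Qed.

(** Every row gets [[:: x]] as an additional first block, which both readings leave alone. *)
Lemma connected_cons x u v : x < 4 -> connected u v -> connected (x :: u) (x :: v).
Proof.
move=> x4 [us Hus E]; exists (map (cons x) us).
  move=> _ /mapP[w /Hus[bs Hbs ->] ->]; exists ([:: x] :: bs) => //=.
  by rewrite Hbs andbT; case: x x4 => [|[|[|[|]]]].
have eo w : old (x :: w) = x :: old w by congr cons; case: x x4 => [|[|[|[|]]]].
have en w : new (x :: w) = x :: new w by congr cons; case: x x4 {eo} => [|[|[|[|]]]].
have M f (c : seq nat -> seq nat) : (forall w, f (x :: w) = x :: c w) -> 
    map f (map (cons x) us) = map (cons x) (map c us).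
  by move=> ef; rewrite -!map_comp; apply: eq_map => w /=; rewrite ef.
by rewrite (M _ _ eo) (M _ _ en) -map_rcons E.
Qed.

(** One row suffices: a swap block followed by single-letter blocks. *)
Lemma connected_swap p q u : (p, q) \in swaps -> all (fun k => k < 4) u ->
  connected [:: p, q & u] [:: q, p & u].
Proof.
move=> Hpq Hu; exists [:: [:: swap_letter p q, swap_letter q p & u]].
  move=> w; rewrite inE => /eqP->.
  exists ([:: swap_letter p q; swap_letter q p] :: [seq [:: k] | k <- u]).
    rewrite /= all_map; apply/andP; split.
      suff: [:: swap_letter p q; swap_letter q p] \in blocks by [].
      rewrite mem_cat (map_f (fun pq => [:: swap_letter pq.1 pq.2; swap_letter pq.2 pq.1]) Hpq).
      exact: orbT.
    by apply: sub_all Hu => -[|[|[|[|]]]].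
  by rewrite /= flatten_map1 map_id.
have H : all (fun pq => [&& rename_letter before (swap_letter pq.1 pq.2) == pq.1,
   rename_letter before (swap_letter pq.2 pq.1) == pq.2,
   rename_letter after (swap_letter pq.1 pq.2) == pq.2 &
   rename_letter after (swap_letter pq.2 pq.1) == pq.1]) swaps by [].
have [e1 e2 e3 e4] : [/\ rename_letter before (swap_letter p q) = p,
    rename_letter before (swap_letter q p) = q, rename_letter after (swap_letter p q) = q &
    rename_letter after (swap_letter q p) = p].
  by have /and4P[/eqP ? /eqP ? /eqP ? /eqP ?] := allP H _ Hpq.
have I f : {in [pred k | k < 4], f =1 id} -> map f u = u.
  by move=> Hf; apply: map_id_in => k ku; apply: Hf; apply: (allP Hu).
have C f x y : map f [:: x, y & u] = [:: f x, f y & map f u] by [].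
rewrite -[LHS]/[:: old [:: swap_letter p q, swap_letter q p & u]; [:: q, p & u]].
rewrite -[RHS]/[:: [:: p, q & u]; new [:: swap_letter p q, swap_letter q p & u]].
rewrite /old /new !C e1 e2 e3 e4.
by rewrite !I // => -[|[|[|[|]]]].
Qed.

(** Sorting by adjacent swaps: a bit [x] moves right through the sorted index letters. Both
    directions go together since each swap can be undone. *)
Lemma connected_sort u : all (fun k => k < 4) u ->
  connected u (indices u ++ bits u) /\ connected (indices u ++ bits u) u.
Proof.
elim: u => [|x u IH] /=; first by split; apply: connected_refl.
case/andP=> x4 u4; have [C1 C2] := IH u4.
have {}C1 := connected_cons x4 C1; have {}C2 := connected_cons x4 C2.
rewrite ltnS; case: (leqP x 1) => x1 //.
suff [D1 D2]: connected (x :: indices u ++ bits u) (indices u ++ x :: bits u) /\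
    connected (indices u ++ x :: bits u) (x :: indices u ++ bits u).
  by split; [apply: connected_trans C1 D1|apply: connected_trans D2 C2].
have: all (fun k => 1 < k < 4) (indices u).
  by apply/allP=> k; rewrite mem_filter => /andP[-> /(allP u4)].
have b4 : all (fun k => k < 4) (bits u).
  by apply/allP=> k; rewrite mem_filter => /andP[_ /(allP u4)].
elim: (indices u) => [|y m IHm] /=; first by split; apply: connected_refl.
case/andP=> /andP[y1 y4] m4; have [D1 D2] := IHm m4.
have w4 : all (fun k => k < 4) (m ++ bits u).
  by rewrite all_cat b4 andbT; apply: sub_all m4 => k /andP[].
have {}D1 := connected_cons y4 D1; have {}D2 := connected_cons y4 D2.
have sw : (x, y) \in swaps /\ (y, x) \in swaps.
  by case: x x1 {x4 C1 C2 IHm D1 D2} => [|[|]] // _; case: y y1 y4 => [|[|[|[|]]]].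
split.
  by apply: connected_trans (connected_swap sw.1 w4) D1.
by apply: connected_trans D2 (connected_swap sw.2 w4).
Qed.

Lemma connectedP u v : all (fun k => k < 4) u -> all (fun k => k < 4) v ->
  bits u = bits v -> indices u = indices v -> connected u v.
Proof.
move=> /connected_sort[Cu _] /connected_sort[_ Cv] Eb Em.
by apply: connected_trans Cu _; rewrite Eb Em.
Qed.

(* The k-th string of an instance is preceded by the index word [2^k 3]. *)
Definition index_word (k : nat) (a : seq bool) : seq nat :=
  rcons (nseq k 2) 3 ++ map nat_of_bool a.
Definition tagged_words (ss : seq (seq bool)) : seq (seq nat) :=
  [seq index_word ks.1 ks.2 | ks <- zip (iota 0 (size ss)) ss].

Lemma nseq_prefix (k l : nat) u v :
  nseq k 2 ++ 3 :: u = nseq l 2 ++ 3 :: v -> k = l /\ u = v.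
Proof.
elim: k l => [|k IH] [|l] //=; first by case.
by case=> /IH[->].
Qed.

Lemma mem_tagged ss a : reflect (exists2 k, k < size ss & a = index_word k (nth [::] ss k))
  (a \in tagged_words ss).
Proof.
have sz : size (zip (iota 0 (size ss)) ss) = size ss by rewrite size_zip size_iota minnn.
apply: (iffP mapP) => [[p /(nthP (0, [::]))[k]]|[k kn ->]].
  rewrite sz => kn <- ->; exists k => //.
  by rewrite nth_zip ?size_iota // nth_iota.
exists (nth (0, [::]) (zip (iota 0 (size ss)) ss) k); first by apply: mem_nth; rewrite sz.
by rewrite nth_zip ?size_iota // nth_iota.
Qed.

(** The part [2^k 3] delimits itself and determines [k], hence the whole tagged word. *)
Lemma tagged_prefix_free ss : prefix_free (tagged_words ss).
Proof.
move=> a b u /mem_tagged[k _ ->] /mem_tagged[l _ ->] /prefixP[v].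
by rewrite /index_word -!catA -!cats1 -!catA /= => /nseq_prefix[->].
Qed.

Lemma all_tagged ss bs : all (mem (tagged_words ss)) bs ->
  exists2 w, all (fun k => k < size ss) w & bs = [seq index_word k (nth [::] ss k) | k <- w].
Proof.
elim: bs => [|b bs IH] /=; first by exists [::].
case/andP=> /mem_tagged[k kn ->] /IH[w Hw ->].
by exists (k :: w); rewrite //= kn.
Qed.

Definition tagged_concat (ss : seq (seq bool)) (w : seq nat) :=
  flatten [seq index_word k (nth [::] ss k) | k <- w].

Lemma tagged4 ss w : all (fun k => k < 4) (tagged_concat ss w).
Proof.
elim: w => //= k w IH; rewrite all_cat IH andbT all_cat all_rcons all_nseq orbT /=.
by rewrite all_map; apply/allP => -[].
Qed.

Lemma bits_tagged ss w : bits (tagged_concat ss w) =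
  map nat_of_bool (flatten [seq nth [::] ss k | k <- w]).
Proof.
elim: w => //= k w IH; rewrite /tagged_concat /= /bits filter_cat -/(bits (flatten _))
  -/(tagged_concat _ _) IH.
rewrite map_cat; congr cat; rewrite /index_word filter_cat filter_rcons filter_nseq /=.
by rewrite filter_map (eq_filter (a2 := predT)) ?filter_predT // => -[].
Qed.

Lemma indices_tagged ss w : indices (tagged_concat ss w) =
  flatten [seq rcons (nseq k 2) 3 | k <- w].
Proof.
elim: w => //= k w IH; rewrite /tagged_concat /= /indices filter_cat -/(indices (flatten _))
  -/(tagged_concat _ _) IH.
congr cat; rewrite /index_word filter_cat filter_rcons filter_nseq /= mul1n.
by rewrite filter_map (eq_filter (a2 := pred0)) ?filter_pred0 ?cats0 // => -[].
Qed.

(** The words [2^k 3] form a prefix code; thus equal index subwords mean the same sequence of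
    indices on both sides. *)
Lemma index_words_inj (w w' : seq nat) :
  flatten [seq rcons (nseq k 2) 3 | k <- w] = flatten [seq rcons (nseq k 2) 3 | k <- w'] ->
  w = w'.
Proof.
elim: w w' => [|k w IH] [|l w'] //=; rewrite -?cats1 -?catA /=.
- by case: l.
- by case: k.
- by case/nseq_prefix=> -> /IH->.
Qed.

(** * The existential sentence *)

Fixpoint quote (t : tree) : term :=
  if t is Node a b then TNode (quote a) (quote b) else TBot.

Lemma term_val_quote v t : term_val v (quote t) = t.
Proof. by elim: t => //= a -> b ->. Qed.

Lemma term_vars_quote t : term_vars (quote t) = [::].
Proof. by elim: t => //= a -> b ->. Qed.

Definition term_subst_words (rs : seq (seq nat)) (t : term) :=
  foldl (fun t a => TSubst t (quote (word a mark)) (quote hole)) t rs.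

Lemma term_val_subst_words v rs t :
  term_val v (term_subst_words rs t) = subst_words rs (term_val v t).
Proof. by elim: rs t => //= a rs IH t; rewrite IH /= !term_val_quote. Qed.

Lemma term_vars_subst_words rs t : term_vars (term_subst_words rs t) = term_vars t.
Proof. by elim: rs t => //= a rs IH t; rewrite IH /= term_vars_quote /= cats0. Qed.

Definition term_rename (ps : seq (nat * nat)) (t : term) :=
  foldl (fun t p => TSubst t (quote (letter p.1)) (quote (letter p.2))) t ps.

Lemma term_val_rename v ps t :
  term_val v (term_rename ps t) = rename ps (term_val v t).
Proof. by elim: ps t => //= a ps IH t; rewrite IH /= !term_val_quote. Qed.

Lemma term_vars_rename ps t : term_vars (term_rename ps t) = term_vars t.
Proof. by elim: ps t => //= a ps IH t; rewrite IH /= !term_vars_quote /= cats0. Qed.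

(** Common shape of all equations of the sentence: substituting for the terminator [e] appends [z]
    to the list [t], and [o] stands in front of [u]. *)
Definition chain_formula (e : tree) (t z o u : term) : eformula :=
  FEq (TSubst t (quote e) (TNode z (quote e))) (TNode o u).

(* Variables: 0 and 1 are chains reaching the words 5 and 6, the rows are the list 4,
   reached by the chain 2 from the list 3 of empty words. *)
Definition rows_formula : eformula :=
  FAnd (FNeq (TVar 5) (quote hole))
  (FAnd (chain_formula eps (TVar 3) (quote hole) (quote hole) (TVar 3))
  (FAnd (chain_formula delta (term_subst_words blocks (TVar 2)) (TVar 4) (TVar 3)
           (TSubst (TVar 2) (quote mark) (quote hole)))
        (chain_formula eps (term_rename before (TVar 4)) (TVar 6) (TVar 5)
           (term_rename after (TVar 4))))).

Definition pcp_body (rs1 rs2 : seq (seq nat)) : eformula :=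
  FAnd (chain_formula eps (term_subst_words rs1 (TVar 0)) (TVar 5) (quote hole)
          (TSubst (TVar 0) (quote mark) (quote hole)))
  (FAnd (chain_formula eps (term_subst_words rs2 (TVar 1)) (TVar 6) (quote hole)
          (TSubst (TVar 1) (quote mark) (quote hole)))
        rows_formula).

Definition close (phi : eformula) : eformula :=
  FEx 0 (FEx 1 (FEx 2 (FEx 3 (FEx 4 (FEx 5 (FEx 6 phi)))))).

Section ClosedFormula.

Local Arguments quote : simpl never.
Local Arguments term_subst_words : simpl never.
Local Arguments term_rename : simpl never.

Lemma pcp_body_closed rs1 rs2 : free_vars (close (pcp_body rs1 rs2)) == [::].
Proof.
by rewrite /= !(term_vars_quote, term_vars_subst_words, term_vars_rename).
Qed.

(** The trees are listed in the order of the variables 0 to 6. *)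
Definition pcp_spec rs1 rs2 (V W H O S x y : tree) : Prop :=
  (tree_subst (subst_words rs1 V) eps (Node x eps) = Node hole (unmark V)) /\
  (tree_subst (subst_words rs2 W) eps (Node y eps) = Node hole (unmark W)) /\
  (x <> hole) /\
  (tree_subst O eps (Node hole eps) = Node hole O) /\
  (tree_subst (subst_words blocks H) delta (Node S delta) = Node O (unmark H)) /\
  (tree_subst (rename before S) eps (Node y eps) = Node x (rename after S)).

Lemma holds_pcp_body v rs1 rs2 : holds v (pcp_body rs1 rs2) <->
  pcp_spec rs1 rs2 (v 0) (v 1) (v 2) (v 3) (v 4) (v 5) (v 6).
Proof.
by rewrite /pcp_body /chain_formula /= !(term_val_quote, term_val_subst_words, term_val_rename).
Qed.

End ClosedFormula.

Lemma holds_close v rs1 rs2 : holds v (close (pcp_body rs1 rs2)) <->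
  exists V W H O S x y, pcp_spec rs1 rs2 V W H O S x y.
Proof.
split=> [[V [W [H [O [S [x [y Hb]]]]]]]|[V [W [H [O [S [x [y Hb]]]]]]]];
  exists V, W, H, O, S, x, y; [case/holds_pcp_body: Hb|apply/holds_pcp_body]; exact.
Qed.

(** * Correctness of the sentence *)

Definition pcp_sentence (I : pcp_instance) : esentence :=
  exist (fun phi => free_vars phi == [::]) _
    (pcp_body_closed (tagged_words (unzip1 (val I))) (tagged_words (unzip2 (val I)))).

(** The words [x] and [y] come from index sequences [w] and [w']. The rows give them equal index
    subwords, so [w = w'], and equal bit subwords, so [w] solves the instance. *)
Lemma pcp_spec_solution ss ss' V W H O S x y : size ss = size ss' ->
  pcp_spec (tagged_words ss) (tagged_words ss') V W H O S x y ->
  exists w, [/\ w != [::], all (fun k => k < size ss) w &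
    flatten [seq nth [::] ss k | k <- w] = flatten [seq nth [::] ss' k | k <- w]].
Proof.
move=> Es [/word_chain_inv[_ /all_tagged[w Hw ->] ->]].
case=> /word_chain_inv[_ /all_tagged[w' Hw' ->] ->] [Nx [EO [EH]]].
have [us -> Hus] := row_chain_inv EO EH.
move/rename_chain=> E; have [] := @connected_sound (tagged_concat ss w) (tagged_concat ss' w').
  by exists us.
rewrite !bits_tagged !indices_tagged => Eb /index_words_inj Ew; subst w'.
(* An empty [w] would make [x] the hole. *)
exists w; split=> //; first by apply: contra_notN Nx => /eqP->.
by move/inj_map: Eb; apply; case=> [] [].
Qed.

Lemma pcp_spec_complete ss ss' w : size ss = size ss' ->
  w != [::] -> all (fun k => k < size ss) w ->
  flatten [seq nth [::] ss k | k <- w] = flatten [seq nth [::] ss' k | k <- w] ->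
  exists V W H O S x y, pcp_spec (tagged_words ss) (tagged_words ss') V W H O S x y.
Proof.
move=> Es Nw Hw E.
have T tt : size tt = size ss ->
    all (mem (tagged_words tt)) [seq index_word k (nth [::] tt k) | k <- w].
  move=> Et; rewrite all_map; apply: sub_all Hw => k kn /=; apply/mem_tagged.
  by exists k; rewrite ?Et.
have [V EV] := word_chain (@tagged_prefix_free ss) (T _ erefl).
have [W EW] := word_chain (@tagged_prefix_free ss') (T _ (esym Es)).
have [us Hus Eus] : connected (tagged_concat ss w) (tagged_concat ss' w).
  by apply: connectedP; rewrite ?tagged4 ?bits_tagged ?indices_tagged ?E.
have [H [O [EO EH]]] := row_chain blocks_prefix_free Hus.
exists V, W, H, O, (lst eps [seq word u hole | u <- us]), (word (tagged_concat ss w) hole),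
  (word (tagged_concat ss' w) hole); do 5?split=> //; last exact/rename_chain.
(* [x] is not the hole: every tagged word contains the letter 3 and so is nonempty. *)
move/(@word_inj 0 _ [::]); case: w Nw {Hw E T EV EW Eus} => // k w _ /(congr1 size).
by rewrite /tagged_concat /= !size_cat size_rcons.
Qed.

Lemma pcp_sentenceP (I : pcp_instance) :
  existential_theory (pcp_sentence I) <-> pcp_solvable I.
Proof.
case: I => s ws; rewrite /existential_theory /pcp_solvable /pcp_solution /=.
have sz1 : size (unzip1 s) = size s by rewrite size_map.
have sz : size (unzip1 s) = size (unzip2 s) by rewrite !size_map.
have F1 (w : seq 'I_(size s)) :
    [seq nth [::] (unzip1 s) k | k <- map val w] = [seq (tnth (in_tuple s) i).1 | i <- w].
  rewrite -map_comp; apply: eq_map => i /=.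
  by rewrite (nth_map ([::], [::])) // (tnth_nth ([::], [::])).
have F2 (w : seq 'I_(size s)) :
    [seq nth [::] (unzip2 s) k | k <- map val w] = [seq (tnth (in_tuple s) i).2 | i <- w].
  rewrite -map_comp; apply: eq_map => i /=.
  by rewrite (nth_map ([::], [::])) // (tnth_nth ([::], [::])).
split=> [/(_ (fun=> Bot))/holds_close[V [W [H [O [S [x [y]]]]]]]|[w [Nw Ew]] v].
  case/(pcp_spec_solution sz)=> w [Nw Hw Ew].
  have [w' Ew'] : exists w' : seq 'I_(size s), w = map val w'.
    rewrite sz1 in Hw; elim: w Hw {Nw Ew} => [|k w IH] /=; first by exists [::].
    by case/andP=> kn /IH[w' ->]; exists (Ordinal kn :: w').
  exists w'; rewrite -F1 -F2 -Ew'; split=> //.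
  by apply: contraNneq Nw => E; rewrite Ew' E.
apply/holds_close; apply: (pcp_spec_complete (w := map val w) sz).
- by case: (w) Nw.
- by rewrite sz1 all_map; apply/allP => i _ /=.
- by rewrite F1 F2.
Qed.

(** * Recursive functions *)

(** Functions of lists rather than tuples: arguments are accessed by [nth], and changes of arity
    need no casts. *)
Definition recursive n (F : seq nat -> nat) : Prop :=
  exists p : recfun n, forall v : n.-tuple nat, rec_eval p v (F v).

Lemma recursive_ext n (F G : seq nat -> nat) : (forall v : n.-tuple nat, F v = G v) ->
  recursive n F -> recursive n G.
Proof. by move=> E [p Hp]; exists p => v; rewrite -E. Qed.

Lemma recursive_proj n i : i < n -> recursive n (fun v => nth 0 v i).
Proof. by move=> ltin; exists (RProj (Ordinal ltin)) => v; rewrite /= (tnth_nth 0). Qed.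

Lemma recursive_comp m n G (h : nat -> seq nat -> nat) : recursive m G ->
  (forall i, i < m -> recursive n (h i)) ->
  recursive n (fun v => G (mkseq (h^~ v) m)).
Proof.
case=> g Hg Hh.
have /fin_all_exists[p Hp] : forall i : 'I_m, exists q : recfun n,
    forall v : n.-tuple nat, rec_eval q v (h i v) by move=> i; apply: Hh.
exists (RComp g p) => v /=; exists [tuple h i v | i < m]; split.
  by move=> i; rewrite tnth_mktuple.
have -> : mkseq (h^~ v) m = [tuple h i v | i < m].
  by rewrite /mkseq -val_enum_ord -map_comp.
exact: Hg.
Qed.

Lemma recursive_comp1 n f F : recursive 1 (fun v => f (nth 0 v 0)) ->
  recursive n F -> recursive n (fun v => f (F v)).
Proof.
by move=> Hf HF; apply: (recursive_comp (h := fun _ => F) Hf).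
Qed.

Lemma recursive_comp2 n f F G : recursive 2 (fun v => f (nth 0 v 0) (nth 0 v 1)) ->
  recursive n F -> recursive n G -> recursive n (fun v => f (F v) (G v)).
Proof.
move=> Hf HF HG.
by apply: (recursive_comp (h := nth F [:: F; G]) Hf) => -[|[|]].
Qed.

Lemma recursive_comp3 n f F G H :
  recursive 3 (fun v => f (nth 0 v 0) (nth 0 v 1) (nth 0 v 2)) ->
  recursive n F -> recursive n G -> recursive n H ->
  recursive n (fun v => f (F v) (G v) (H v)).
Proof.
move=> Hf HF HG HH.
by apply: (recursive_comp (h := nth F [:: F; G; H]) Hf) => -[|[|[|]]].
Qed.

Lemma recursive_succ n F : recursive n F -> recursive n (fun v => (F v).+1).
Proof.
apply: recursive_comp1; exists RSucc => v.
by case/tupleP: v => x v; rewrite /= theadE.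
Qed.

Lemma recursive_const n c : recursive n (fun=> c).
Proof. by elim: c => [|c IH]; [exists (RZero n)|apply: recursive_succ]. Qed.

Lemma recursive_weaken n F : recursive n F ->
  recursive n.+2 (fun v => F (behead (behead v))).
Proof.
move=> HF; apply: (recursive_ext (F := fun v => F (mkseq (fun i => nth 0 v i.+2) n))).
  move=> v; congr F; case/tupleP: v => x v; case/tupleP: v => y v.
  by apply: (@eq_from_nth _ 0) => [|i]; rewrite size_mkseq /= ?size_tuple // => lti;
    rewrite nth_mkseq.
apply: (recursive_comp (h := fun i v => nth 0 v i.+2)) => // i lti.
exact: recursive_proj.
Qed.

(** [RPrec] recurses on its first argument; composing it with [K] and the projections allows any
    recursive bound. *)
Lemma recursive_rec n K G H : recursive n K -> recursive n G -> recursive n.+2 H ->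
  recursive n (fun v =>
    nat_rect (fun=> nat) (G v) (fun k r => H [:: k, r & v]) (K v)).
Proof.
move=> HK [g Hg] [h Hh].
have R : recursive n.+1 (fun v => nat_rect (fun=> nat) (G (behead v))
    (fun k r => H [:: k, r & behead v]) (head 0 v)).
  exists (RPrec g h) => v /=.
  have -> : head 0 v = thead v by case/tupleP: v => x v; rewrite theadE.
  elim: (thead v) => [|x IH] /=; first exact: (Hg [tuple of behead v]).
  set r := nat_rect _ _ _ x in IH *; exists r; split; first exact: IH.
  exact: (Hh [tuple of [:: x, r & behead v]]).
apply: (recursive_ext _ (recursive_comp (n := n)
  (h := fun i => if i is j.+1 then nth 0 ^~ j else K) R _)).
  move=> v; rewrite /=.
  suff -> : [seq (if i is j.+1 then nth 0 ^~ j else K) v | i <- iota 1 n] = v by [].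
  rewrite (iotaDl 1 0) -map_comp; apply: (@eq_from_nth _ 0) => [|i].
    by rewrite size_map size_iota size_tuple.
  by rewrite size_map size_iota => lti; rewrite (nth_map 0) ?size_iota // nth_iota.
by case=> // i; rewrite ltnS; apply: recursive_proj.
Qed.

(** Recursion on [F v] with base [A] and a step that ignores the counter and the previous value and
    returns [B]. *)
Lemma recursive_if n F A B : recursive n F -> recursive n A -> recursive n B ->
  recursive n (fun v => if F v == 0 then A v else B v).
Proof.
move=> HF HA HB; apply: (recursive_ext _ (recursive_rec HF HA (recursive_weaken HB))).
by move=> v; case: (F v).
Qed.

Lemma recursive_add n F G : recursive n F -> recursive n G ->
  recursive n (fun v => F v + G v).
Proof.
apply: (recursive_comp2 (f := addn)).
have H := @recursive_rec 2 _ _ _ (@recursive_proj 2 0 isT) (@recursive_proj 2 1 isT)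
  (recursive_succ (@recursive_proj 4 1 isT)).
apply: recursive_ext H => v /=.
by elim: (nth 0 v 0) => //= k ->.
Qed.

Lemma recursive_mul n F G : recursive n F -> recursive n G ->
  recursive n (fun v => F v * G v).
Proof.
apply: (recursive_comp2 (f := muln)).
have H := @recursive_rec 2 _ _ _ (@recursive_proj 2 0 isT) (recursive_const 2 0)
  (recursive_add (@recursive_proj 4 3 isT) (@recursive_proj 4 1 isT)).
apply: recursive_ext H => v /=.
by elim: (nth 0 v 0) => //= k ->; rewrite mulSn.
Qed.

Lemma recursive_exp2 n F : recursive n F -> recursive n (fun v => 2 ^ F v).
Proof.
apply: (recursive_comp1 (f := expn 2)).
have H := @recursive_rec 1 _ _ _ (@recursive_proj 1 0 isT) (recursive_const 1 1)
  (recursive_add (@recursive_proj 3 1 isT) (@recursive_proj 3 1 isT)).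
apply: recursive_ext H => v /=.
by elim: (nth 0 v 0) => //= k ->; rewrite expnS mul2n addnn.
Qed.

Lemma recursive_odd n F : recursive n F -> recursive n (fun v => odd (F v) : nat).
Proof.
apply: (recursive_comp1 (f := fun k => odd k : nat)).
have H := @recursive_rec 1 _ _ _ (@recursive_proj 1 0 isT) (recursive_const 1 0)
  (recursive_if (@recursive_proj 3 1 isT) (recursive_const 3 1) (recursive_const 3 0)).
apply: recursive_ext H => v /=.
by elim: (nth 0 v 0) => //= k ->; case: (odd k).
Qed.

(** The recursion is [k.+1./2 = odd k + k./2]. *)
Lemma recursive_half n F : recursive n F -> recursive n (fun v => (F v)./2).
Proof.
apply: (recursive_comp1 (f := half)).
have H := @recursive_rec 1 _ _ _ (@recursive_proj 1 0 isT) (recursive_const 1 0)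
  (recursive_add (recursive_odd (@recursive_proj 3 0 isT)) (@recursive_proj 3 1 isT)).
apply: recursive_ext H => v /=.
by elim: (nth 0 v 0) => //= k ->; rewrite uphalf_half.
Qed.

(** * Recursive operations on codes of lists *)

Definition code_cons (x y : nat) : nat := 2 ^ x * y.*2.+1.

Lemma code_consE x s : CodeSeq.code (x :: s) = code_cons x (CodeSeq.code s).
Proof. by []. Qed.

Lemma recursive_code_cons n F G : recursive n F -> recursive n G ->
  recursive n (fun v => code_cons (F v) (G v)).
Proof.
move=> HF HG; apply: recursive_mul; first exact: recursive_exp2.
apply: recursive_succ; apply: (recursive_ext (F := fun v => G v + G v)).
  by move=> v; rewrite addnn.
exact: recursive_add.
Qed.

(* Halves x as long as it is even, at most k times: for a code [2 ^ a * (2 b + 1)] this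
   exposes both the head a and the tail b. *)
Definition strip (x k : nat) : nat :=
  nat_rect (fun=> nat) x (fun _ r => if odd r == 0 :> nat then r./2 else r) k.

Lemma strip_code_cons x y k : strip (code_cons x y) k = 2 ^ (x - k) * y.*2.+1.
Proof.
elim: k => [|k IH]; first by rewrite subn0.
rewrite /= -/(strip _ _) IH subnS; case: (x - k) => [|n].
  by rewrite mul1n /= odd_double.
by rewrite expnS -mulnA mul2n odd_double /= doubleK.
Qed.

Lemma recursive_strip n F G : recursive n F -> recursive n G ->
  recursive n (fun v => strip (F v) (G v)).
Proof.
apply: (recursive_comp2 (f := strip)).
exact: (@recursive_rec 2 _ _ _ (@recursive_proj 2 1 isT) (@recursive_proj 2 0 isT)
  (recursive_if (recursive_odd (@recursive_proj 4 1 isT))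
    (recursive_half (@recursive_proj 4 1 isT)) (@recursive_proj 4 1 isT))).
Qed.

(** In a nonzero code [x] the exponent of 2 is below [x], so [x] rounds leave the odd part, and
    halving drops its last bit. *)
Definition code_tail (x : nat) : nat := (strip x x)./2.
(** Counts the rounds [k] after which an even number is left: these are exactly the [k] below the
    exponent of 2. *)
Definition code_head (x : nat) : nat :=
  nat_rect (fun=> nat) 0 (fun k r => if odd (strip x k) == 0 :> nat then r.+1 else r) x.

Lemma leq_code_cons x y : x < code_cons x y.
Proof. by apply: leq_trans (ltn_expl x (ltnSn 1)) _; rewrite leq_pmulr. Qed.

Lemma code_tail_cons x y : code_tail (code_cons x y) = y.
Proof.
rewrite /code_tail strip_code_cons (eqP (_ : x - _ == 0)).
  by rewrite mul1n /= uphalf_double.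
by rewrite subn_eq0 ltnW ?leq_code_cons.
Qed.

Lemma code_head_cons x y : code_head (code_cons x y) = x.
Proof.
have E k : nat_rect (fun=> nat) 0
    (fun k r => if odd (strip (code_cons x y) k) == 0 :> nat then r.+1 else r) k = minn k x.
  elim: k => [|k IH]; first by rewrite min0n.
  rewrite /= IH strip_code_cons oddM oddX /= odd_double andbT orbF subn_eq0 eqb0 -ltnNge.
by case: ltnP => [lt|ge]; rewrite ?(minn_idPl lt) ?(minn_idPl (ltnW lt)) //
    !(minn_idPr _) // leqW.
by rewrite /code_head E; apply/minn_idPr/ltnW/leq_code_cons.
Qed.

Lemma recursive_code_tail n F : recursive n F -> recursive n (fun v => code_tail (F v)).
Proof. by move=> HF; apply: recursive_half; apply: recursive_strip. Qed.

Lemma recursive_code_head n F : recursive n F -> recursive n (fun v => code_head (F v)).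
Proof.
apply: (recursive_comp1 (f := code_head)).
exact: (@recursive_rec 1 _ _ _ (@recursive_proj 1 0 isT) (recursive_const 1 0)
  (recursive_if
    (recursive_odd (recursive_strip (@recursive_proj 3 2 isT) (@recursive_proj 3 0 isT)))
    (recursive_succ (@recursive_proj 3 1 isT)) (@recursive_proj 3 1 isT))).
Qed.

Definition code_drop (x k : nat) : nat := nat_rect (fun=> nat) x (fun=> code_tail) k.

Lemma code_dropE s k : code_drop (CodeSeq.code s) k = CodeSeq.code (drop k s).
Proof.
elim: k => [|k IH]; first by rewrite drop0.
rewrite /= -/(code_drop _ _) IH -add1n -drop_drop drop1.
by case: (drop k s) => [|x t]; [|exact: code_tail_cons].
Qed.

Lemma recursive_code_drop n F G : recursive n F -> recursive n G ->
  recursive n (fun v => code_drop (F v) (G v)).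
Proof.
apply: (recursive_comp2 (f := code_drop)).
exact: (@recursive_rec 2 _ _ _ (@recursive_proj 2 1 isT) (@recursive_proj 2 0 isT)
  (recursive_code_tail (@recursive_proj 4 1 isT))).
Qed.

(** The number [x] of rounds is at least the length of the coded list; once the list is exhausted,
    its remainder has code 0 and the value stays fixed. *)
Definition code_fold (h : nat -> nat -> nat -> nat) (z x : nat) : nat :=
  nat_rect (fun=> nat) z (fun k r =>
    if code_drop x k == 0 then r else h k (code_head (code_drop x k)) r) x.

Lemma code_foldE h z s : code_fold h z (CodeSeq.code s) =
  foldl (fun r kx => h kx.1 kx.2 r) z (zip (iota 0 (size s)) s).
Proof.
have sz : size (zip (iota 0 (size s)) s) = size s by rewrite size_zip size_iota minnn.
have le_size : size s <= CodeSeq.code s.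
  elim: (s) => // x t IH; rewrite code_consE /code_cons -[(size _)]/(size t).+1.
  apply: leq_trans (leq_pmull _ _); last by rewrite expn_gt0.
  by rewrite ltnS; apply: leq_trans IH _; rewrite -addnn leq_addr.
rewrite /code_fold -{1}[zip _ _](take_oversize (n := CodeSeq.code s)) ?sz //.
(* The number of rounds is generalised: after [k] of them the first [k] entries have been
   treated. *)
elim: {3 4}(CodeSeq.code s) => [|k IH]; first by rewrite take0.
rewrite [LHS]/= IH code_dropE; case: (ltnP k (size s)) => [lt|ge].
  rewrite (drop_nth 0) // code_consE code_head_cons.
  rewrite (take_nth (0, 0)) ?sz // -cats1 foldl_cat /= nth_zip ?size_iota // nth_iota // add0n.
  by rewrite gtn_eqF // (leq_ltn_trans _ (leq_code_cons _ _)).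
rewrite drop_oversize // [CodeSeq.code _]/= eqxx !take_oversize ?sz //.
exact: leqW.
Qed.

Lemma recursive_code_fold n h Z X :
  recursive 3 (fun v => h (nth 0 v 0) (nth 0 v 1) (nth 0 v 2)) ->
  recursive n Z -> recursive n X -> recursive n (fun v => code_fold h (Z v) (X v)).
Proof.
move=> Hh; apply: (recursive_comp2 (f := code_fold h)).
have D := recursive_code_drop (@recursive_proj 4 3 isT) (@recursive_proj 4 0 isT).
exact: (@recursive_rec 2 _ _ _ (@recursive_proj 2 1 isT) (@recursive_proj 2 0 isT)
  (recursive_if D (@recursive_proj 4 1 isT)
    (recursive_comp3 Hh (@recursive_proj 4 0 isT) (recursive_code_head D)
       (@recursive_proj 4 1 isT)))).
Qed.

Lemma recursive_code_list n (Fs : seq (seq nat -> nat)) :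
  (forall i, i < size Fs -> recursive n (nth (fun=> 0) Fs i)) ->
  recursive n (fun v => CodeSeq.code [seq F v | F <- Fs]).
Proof.
elim: Fs => [|F Fs IH] H; first exact: (recursive_const n 0).
apply: (recursive_code_cons (H 0 isT)); apply: IH => i; exact: (H i.+1).
Qed.

Lemma recursive_code3 n c F G : recursive n F -> recursive n G ->
  recursive n (fun v => CodeSeq.code [:: c; F v; G v]).
Proof.
move=> HF HG; apply: (@recursive_code_list n [:: fun=> c; F; G]) => -[|[|[|]]] // _.
exact: recursive_const.
Qed.

Lemma recursive_code4 n c F G H : recursive n F -> recursive n G -> recursive n H ->
  recursive n (fun v => CodeSeq.code [:: c; F v; G v; H v]).
Proof.
move=> HF HG HH.
apply: (@recursive_code_list n [:: fun=> c; F; G; H]) => -[|[|[|[|]]]] // _.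
exact: recursive_const.
Qed.

(** * Computing the code of the sentence *)

(** When [w] codes a quoted word, this codes the word with [l] added at the root; 2 is the tag of
    [TNode]. *)
Definition code_letter_word (l w : nat) :=
  CodeSeq.code [:: 2; code_term (quote (letter l)); w].

Lemma recursive_code_letter_word n l F : recursive n F ->
  recursive n (fun v => code_letter_word l (F v)).
Proof. by move=> HF; apply: recursive_code3 => //; apply: recursive_const. Qed.

Lemma code_wordE u x : code_term (quote (word u x)) =
  foldl (fun r l => code_letter_word l r) (code_term (quote x)) u.
Proof. by elim: u x => // l u IH x; rewrite [LHS]IH. Qed.

Lemma foldl_zip_iota (T R : Type) (h : R -> T -> R) z m s :
  foldl (fun r kx => h r kx.2) z (zip (iota m (size s)) s) = foldl h z s.
Proof. by elim: s z m => //= x s IH z m; rewrite IH. Qed.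

Lemma foldl_nseq (h : nat -> nat -> nat) z k l :
  foldl (fun r l => h l r) z (nseq k l) = nat_rect (fun=> nat) z (fun _ => h l) k.
Proof.
have C r m : nat_rect (fun=> nat) (h l r) (fun _ => h l) m =
    nat_rect (fun=> nat) r (fun _ => h l) m.+1.
  by elim: m => //= m ->.
by elim: k z => // k IH z; rewrite /= IH C.
Qed.

Lemma foldl_bits (h : nat -> nat -> nat) z (a : seq bool) :
  foldl (fun r b => if b == 0 then h 0 r else h 1 r) z (map nat_of_bool a) =
  foldl (fun r l => h l r) z (map nat_of_bool a).
Proof. by elim: a z => //= b a IH z; rewrite IH; case: b. Qed.

(** The recursion writes the letters 2 and the fold writes the bits. Bits are told apart by a test,
    so that each letter written is a constant of the program. *)
Definition code_index_word (k s : nat) : nat :=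
  code_fold (fun _ b r => if b == 0 then code_letter_word 0 r else code_letter_word 1 r)
    (code_letter_word 3 (nat_rect (fun=> nat) (code_term (quote mark))
       (fun _ => code_letter_word 2) k)) s.

Lemma code_fold_index_word (h : nat -> nat -> nat) z k a :
  code_fold (fun _ b r => if b == 0 then h 0 r else h 1 r)
    (h 3 (nat_rect (fun=> nat) z (fun _ => h 2) k)) (code_string a) =
  foldl (fun r l => h l r) z (index_word k a).
Proof.
rewrite /index_word foldl_cat foldl_rcons foldl_nseq -foldl_bits code_foldE.
exact: (foldl_zip_iota (fun r b => if b == 0 then h 0 r else h 1 r)).
Qed.

Lemma code_index_wordE k a : code_index_word k (code_string a) =
  code_term (quote (word (index_word k a) mark)).
Proof. by rewrite code_wordE -(code_fold_index_word code_letter_word). Qed.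

Lemma recursive_code_index_word n F G : recursive n F -> recursive n G ->
  recursive n (fun v => code_index_word (F v) (G v)).
Proof.
apply: (recursive_comp2 (f := code_index_word)).
apply: (recursive_code_fold (h := fun _ b r =>
  if b == 0 then code_letter_word 0 r else code_letter_word 1 r) (X := nth 0 ^~ 1)).
- apply: recursive_if; first exact: recursive_proj.
    by apply: recursive_code_letter_word; apply: recursive_proj.
  by apply: recursive_code_letter_word; apply: recursive_proj.
- apply: recursive_code_letter_word.
  exact: (@recursive_rec 2 _ _ _ (@recursive_proj 2 0 isT) (recursive_const 2 _)
    (recursive_code_letter_word 2 (@recursive_proj 4 1 isT))).
- exact: recursive_proj.
Qed.

(** Each pair of the instance wraps one [TSubst], with tag 3, around the term; its position [k] is
    the index in the tagged word, and [f] extracts a component of the pair from its code. *)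
Definition code_subst_words (f : nat -> nat) (t x : nat) : nat :=
  code_fold (fun k c r =>
    CodeSeq.code [:: 3; r; code_index_word k (f c); code_term (quote hole)]) t x.

Lemma code_subst_wordsE f (sel : seq bool * seq bool -> seq bool) s t :
  (forall ab, f (CodeSeq.code [:: code_string ab.1; code_string ab.2]) = code_string (sel ab)) ->
  code_subst_words f (code_term t)
    (CodeSeq.code [seq CodeSeq.code [:: code_string ab.1; code_string ab.2] | ab <- s]) =
  code_term (term_subst_words (tagged_words (map sel s)) t).
Proof.
move=> Hf; rewrite /code_subst_words code_foldE /tagged_words !size_map.
(* Positions are counted from an arbitrary [m], since the induction on [s] shifts them. *)
move: {2 3}0 => m.
elim: s m t => // p s IH m t.
rewrite -[RHS]IH -[LHS]/(foldl _ (CodeSeq.code [:: 3; code_term t;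
  code_index_word m (f (CodeSeq.code [:: code_string p.1; code_string p.2]));
  code_term (quote hole)]) _) Hf code_index_wordE.
by [].
Qed.

Lemma recursive_code_subst_words f t : recursive 1 (fun v => f (nth 0 v 0)) ->
  recursive 1 (fun v => code_subst_words f t (nth 0 v 0)).
Proof.
move=> Hf; apply: recursive_code_fold (recursive_const _ _) (@recursive_proj 1 0 isT).
apply: recursive_code4; first exact: recursive_proj.
  apply: recursive_code_index_word; first exact: recursive_proj.
  by apply: (recursive_comp1 Hf); apply: recursive_proj.
exact: recursive_const.
Qed.

(** Only the term inside the substitution varies with the instance; the rest of the equation is
    constant. *)
Lemma recursive_code_chain e z o u F : recursive 1 F ->
  recursive 1 (fun v => CodeSeq.code [:: 0;
    CodeSeq.code [:: 3; F v; code_term (quote e); code_term (TNode z (quote e))];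
    code_term (TNode o u)]).
Proof.
move=> HF; apply: recursive_code3; last exact: recursive_const.
by apply: recursive_code4 => //; apply: recursive_const.
Qed.

Lemma recursive_code_close F : recursive 1 F ->
  recursive 1 (fun v => foldr (fun x c => CodeSeq.code [:: 4; x; c]) (F v) (iota 0 7)).
Proof.
by move=> HF; do 7!(apply: recursive_code3; first exact: recursive_const).
Qed.

Lemma pcp_sentence_computable : computable code_pcp code_esentence pcp_sentence.
Proof.
(* A pair is coded as a list of two entries, which are its head and the head of its tail. *)
pose F v := code_subst_words code_head (code_term (TVar 0)) (nth 0 v 0).
pose G v := code_subst_words (fun c => code_head (code_tail c)) (code_term (TVar 1)) (nth 0 v 0).
have HF : recursive 1 F.
  by apply: recursive_code_subst_words; apply: recursive_code_head; apply: recursive_proj.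
have HG : recursive 1 G.
  apply: recursive_code_subst_words; apply: recursive_code_head.
  by apply: recursive_code_tail; apply: recursive_proj.
have C1 := recursive_code_chain eps (TVar 5) (quote hole)
  (TSubst (TVar 0) (quote mark) (quote hole)) HF.
have C2 := recursive_code_chain eps (TVar 6) (quote hole)
  (TSubst (TVar 1) (quote mark) (quote hole)) HG.
(* [rows_formula] is the same for all instances, so its code enters as a constant; 2 is the tag of
   [FAnd]. *)
have [p Hp] := recursive_code_close (recursive_code3 2 C1
  (recursive_code3 2 C2 (recursive_const 1 (code_eformula rows_formula)))).
exists p => I; move: (Hp [tuple code_pcp I]).
rewrite /F /G [nth 0 _ 0]/(code_pcp I) /code_pcp.
rewrite (@code_subst_wordsE _ fst); last by move=> ab; rewrite code_consE code_head_cons.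
rewrite (@code_subst_wordsE _ snd); last first.
  by move=> ab; rewrite !code_consE code_tail_cons code_head_cons.
exact.
Qed.

Theorem theorem7 :
  exists f : pcp_instance -> esentence,
    computable code_pcp code_esentence f /\
    (forall I : pcp_instance, existential_theory (f I) <-> pcp_solvable I).
Proof.
by exists pcp_sentence; split; [exact: pcp_sentence_computable|exact: pcp_sentenceP].
Qed.
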